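(* Let $n\ge 1$ and let $f\in\mathscr{S}=\mathscr{S}(\mathbb{R}^n,\mathbb{R})$. Then: (1) $f$ is parity-even if and only if $\mathscr{F}_{\mathbb{R}}[f]$ is parity-even; (2) $f$ is parity-odd if and only if $\mathscr{F}_{\mathbb{R}}[f]$ is parity-odd.
   Context: $\mathscr{S}=\mathscr{S}(\mathbb{R}^n,\mathbb{R})$ is the real vector space of real-valued Schwartz functions on $\mathbb{R}^n$; $\cdot$ in $\mathbf{y}\cdot\mathbf{x}$ is the Euclidean inner product. The real Fourier transform is the linear operator $\mathscr{F}_{\mathbb{R}}:\mathscr{S}\to\mathscr{S}$, $$\mathscr{F}_{\mathbb{R}}[f](\mathbf{y})=\frac{1}{\sqrt{(2\pi)^n}}\int_{\mathbb{R}^n} f(\mathbf{x})\big(\cos(\mathbf{y}\cdot\mathbf{x})-\sin(\mathbf{y}\cdot\mathbf{x})\big)\,d\mathbf{x}.$$ A function $f$ on $\mathbb{R}^n$ is parity-even if $f(-\mathbf{x})=f(\mathbf{x})$ for every $\mathbf{x}\in\mathbb{R}^n$, and parity-odd if $f(-\mathbf{x})=-f(\mathbf{x})$ for every $\mathbf{x}\in\mathbb{R}^n$. *)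

(* Defs.v *)
From HB Require Import structures.
From mathcomp Require Import all_boot all_order all_algebra.
From mathcomp Require Import all_classical all_reals all_analysis.

Set Implicit Arguments.
Unset Strict Implicit.
Unset Printing Implicit Defensive.

Import Order.TTheory GRing.Theory Num.Theory.
Import numFieldNormedType.Exports.

Local Open Scope classical_set_scope.
Local Open Scope ring_scope.

Section LebesgueMeasureTuple.
Variable R : realType.
Local Notation RT := (measurableTypeR R).

Definition tcons n (p : RT * n.-tuple RT) : n.+1.-tuple RT :=
  [tuple of p.1 :: p.2].

Lemma measurable_tcons n : measurable_fun [set: RT * n.-tuple RT] (@tcons n).
Proof. by apply: measurable_cons. Qed.

Section Cons.
Variables (n : nat) (m : {sigma_finite_measure set (n.-tuple RT) -> \bar R}).

Definition lebesgue_cons : set (n.+1.-tuple RT) -> \bar R :=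
  pushforward (lebesgue_measure \x m)%E (@tcons n).

Let lebesgue_cons0 : lebesgue_cons set0 = 0%E.
Proof. by rewrite /lebesgue_cons /pushforward preimage_set0 measure0. Qed.

Let lebesgue_cons_ge0 A : (0 <= lebesgue_cons A)%E.
Proof. by rewrite /lebesgue_cons /pushforward; exact: measure_ge0. Qed.

Let lebesgue_cons_sigma_additive : semi_sigma_additive lebesgue_cons.
Proof.
move=> F mF tF mUF; rewrite /lebesgue_cons /pushforward preimage_bigcup.
apply: measure_semi_sigma_additive.
- by move=> k; rewrite -[X in measurable X]setTI; exact: measurable_tcons.
- apply/trivIsetP => /= i j _ _ ij; rewrite -preimage_setI.
  by move/trivIsetP : tF => /(_ _ _ _ _ ij) ->//; rewrite preimage_set0.
- rewrite -preimage_bigcup -[X in measurable X]setTI.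
  exact: measurable_tcons.
Qed.

HB.instance Definition _ := isMeasure.Build _ _ _ lebesgue_cons
  lebesgue_cons0 lebesgue_cons_ge0 lebesgue_cons_sigma_additive.

Let tuncons (t : n.+1.-tuple RT) : RT * n.-tuple RT :=
  (thead t, [tuple of behead t]).

Let tconsK : cancel (@tcons n) tuncons.
Proof.
by case=> x t; rewrite /tcons /tuncons/= theadE; congr pair; apply/val_inj.
Qed.

Let measurable_tuncons : measurable_fun setT tuncons.
Proof.
apply: measurable_fun_pair; first exact: measurable_tnth.
exact: measurable_behead.
Qed.

Let lebesgue_cons_sigma_finite : sigma_finite setT lebesgue_cons.
Proof.
have /sigma_finiteP[F [TF ndF Foo]] := sigma_finiteT
  (@lebesgue_measure R : {sigma_finite_measure set RT -> \bar R}).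
have /sigma_finiteP[G [TG ndG Goo]] := sigma_finiteT m.
exists (fun k => tuncons @^-1` (F k `*` G k)).
  rewrite -preimage_bigcup (_ : \bigcup_i _ = setT) ?preimage_setT//.
  rewrite -subTset => -[x t] _; have : setT x by []; have : setT t by [].
  rewrite TF TG => -[j _ Gjt] [i _ Fix]; exists (maxn i j) => //; split => /=.
  - by move: x Fix; exact/subsetPset/ndF/leq_maxl.
  - by move: t Gjt; exact/subsetPset/ndG/leq_maxr.
move=> k; have [mF Fkoo] := Foo k; have [mG Gkoo] := Goo k; split.
  rewrite -[X in measurable X]setTI; apply: measurable_tuncons => //.
  exact: measurableX.
rewrite /lebesgue_cons /pushforward -comp_preimage.
rewrite (_ : tuncons \o _ = id); last by apply/funext => p; exact: tconsK.
rewrite preimage_id [ltLHS]product_measure1E//.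
by rewrite lte_mul_pinfty// ge0_fin_numE.
Qed.

HB.instance Definition _ := Measure_isSigmaFinite.Build _ _ _ lebesgue_cons
  lebesgue_cons_sigma_finite.

End Cons.

(* Lebesgue measure on the n-fold product of the Borel line, as an iterated
   product measure; on the one-point space R^0 it is the unit mass. *)
Fixpoint lebesgue_tuple n : {sigma_finite_measure set (n.-tuple RT) -> \bar R} :=
  match n with
  | 0 => \d_ ([tuple] : 0.-tuple RT)
  | k.+1 => lebesgue_cons (lebesgue_tuple k)
  end.

Lemma lebesgue_tuple_box n (A : 'I_n -> set RT) :
  (forall i, measurable (A i)) ->
  lebesgue_tuple n [set t | forall i, A i (tnth t i)] =
  (\prod_(i < n) lebesgue_measure (A i))%E.
Proof.
elim: n A => [|n IHn] A mA /=.
  by rewrite big_ord0 diracE mem_set//= => -[].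
have mB : measurable [set t : n.-tuple RT | forall i, A (lift ord0 i) (tnth t i)].
  rewrite (_ : mkset _ =
      \bigcap_(i in [set: 'I_n]) ((@tnth n RT)^~ i @^-1` A (lift ord0 i))).
    apply: fin_bigcap_measurable => // i _; rewrite -[X in measurable X]setTI.
    exact: measurable_tnth.
  by apply/seteqP; split => t At i; [move=> _|]; exact: At.
rewrite big_ord_recl -IHn// -product_measure1E//.
congr ((_ \x _)%E _); apply/seteqP; split=> -[x t] /=.
  move=> At; split; first exact: (At ord0).
  by move=> i; have := At (lift ord0 i); rewrite /tcons tnthS.
case=> Ax At i; case: (unliftP ord0 i) => [j ->|->//].
by rewrite /tcons tnthS.
Qed.

End LebesgueMeasureTuple.

Section Schwartz.
Variables (R : realType) (n : nat).
Implicit Types (f : 'rV[R]_n -> R) (x y : 'rV[R]_n).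

Definition partial (i : 'I_n) f : 'rV[R]_n -> R :=
  fun x => 'D_(delta_mx 0 i) f x.

Definition smooth f := forall s : seq 'I_n,
  continuous (foldr partial f s) /\
  forall i x, derivable (foldr partial f s) x (delta_mx 0 i).

Definition monomial (a : {ffun 'I_n -> nat}) x : R := \prod_i x 0 i ^+ a i.

Definition multi_partial (b : {ffun 'I_n -> nat}) f : 'rV[R]_n -> R :=
  foldr (fun i => iter (b i) (partial i)) f (enum 'I_n).

Definition schwartz : set ('rV[R]_n -> R) := [set f | smooth f /\
  forall a b, exists C : R, forall x, `|monomial a x * multi_partial b f x| <= C].

Definition dot x y : R := \sum_i x 0 i * y 0 i.

(* R^n appears as 'rV[R]_n for its normed-space structure and as n.-tuple for its
   product sigma-algebra; vec identifies the two coordinatewise. *)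
Definition vec (t : n.-tuple (measurableTypeR R)) : 'rV[R]_n :=
  \row_i (tnth t i : R).

(* For Schwartz f the integrand is Lebesgue integrable, so that Rintegral is
   the genuine integral and not the default value of fine. *)
Definition real_fourier f : 'rV[R]_n -> R := fun y =>
  (Num.sqrt ((2 * pi) ^+ n))^-1 *
  \int[lebesgue_tuple R n]_t
    (f (vec t) * (cos (dot y (vec t)) - sin (dot y (vec t)))).

Definition parity_even f := forall x, f (- x) = f x.

Definition parity_odd f := forall x, f (- x) = - f x.

End Schwartz.

(* Main.v *)
(** Reflecting [f] reflects its real Fourier transform, because Lebesgue measure
    is invariant under [x |-> -x]; so both equivalences reduce to the injectivity
    of the transform on Schwartz functions. As [cos (theta + p)] is a combination of
    [cos p - sin p] and [cos (- p) - sin (- p)], a function [g] with vanishing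
    transform is orthogonal to every wave [cos (theta + s . t)]. On the line,
    averaging these waves with weight [exp (- e |y|)] gives the Poisson kernel
    [2 e / (e^2 + (x - z)^2)], and a continuous [g] orthogonal to all its translates
    is zero, since as [e -> 0] the peak at [z] outweighs the tails. In higher
    dimension one splits off one variable at a time: the partial transform in the
    remaining variables is continuous and integrable in the first one. *)
Require Import Defs.
From mathcomp Require Import all_boot all_order all_algebra.
From mathcomp Require Import all_classical all_reals all_analysis.
From mathcomp Require Import measurable_realfun.
From mathcomp Require Import ring lra.

Set Implicit Arguments.
Unset Strict Implicit.
Unset Printing Implicit Defensive.

Import Order.TTheory GRing.Theory Num.Theory.
Import numFieldNormedType.Exports.

Local Open Scope classical_set_scope.
Local Open Scope ring_scope.

(** * The integral over the line of [exp (- e |y|)] against a cosine *)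

Section LaplaceCosine.
Variable R : realType.
Implicit Types e x y : R.

(** Antiderivative of [expR (- e * y) * (1 + cos (x * y))]. The summand 1 makes the integrand
    nonnegative, as the fundamental theorem of calculus on a half-line requires here; [laplace_cos]
    removes it again. *)
Let primitive e x (y : R) : R :=
  expR (- e * y) *
    ((x * sin (x * y) - e * cos (x * y)) / (e ^+ 2 + x ^+ 2) - e^-1).

Let is_derive_primitive e x y : 0 < e ->
  is_derive y 1 (primitive e x) (expR (- e * y) * (1 + cos (x * y))).
Proof.
move=> e0.
have dl c : is_derive y 1 ( *%R c) c.
  have -> : *%R c = c \*: (@id R) by [].
  by apply: is_derive_eq; rewrite /GRing.scale/= mulr1.
have -> : primitive e x = (expR \o *%R (- e)) *
    (((e ^+ 2 + x ^+ 2)^-1 \*: (x \*: (sin \o *%R x) - e \*: (cos \o *%R x)))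
      - cst e^-1).
  by apply/funext => t; rewrite /primitive !fctE /GRing.scale/= [X in X - _]mulrC.
have e2x : e ^+ 2 + x ^+ 2 != 0 by rewrite gt_eqF// ltr_wpDr ?sqr_ge0 ?exprn_gt0.
apply: is_derive_eq; rewrite !fctE /GRing.scale/=.
rewrite -![_ *: _]/(_ * _).
by field; rewrite e2x gt_eqF.
Qed.

Lemma cvg_bounded_mul (f g : R -> R) M : (forall y, `|g y| <= M) ->
  f y @[y --> +oo] --> 0 -> f y * g y @[y --> +oo] --> 0.
Proof.
move=> gM f0; apply/norm_cvg0P.
have M0 : 0 <= M by exact: le_trans (gM 0).
apply: (@squeeze_cvgr _ _ _ _ (cst 0) (fun y => `|f y| * M)).
- near=> y; rewrite /= normr_ge0/= normrM ler_wpM2l//.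
- exact: cvg_cst.
- by rewrite -(mul0r M) -(@normr0 R R); apply: cvgMr_tmp; apply: cvg_norm.
Unshelve. all: by end_near. Qed.

Let cvg_primitive e x : 0 < e -> primitive e x y @[y --> +oo] --> 0.
Proof.
move=> e0; apply: (@cvg_bounded_mul _ _ ((`|x| + e) / (e ^+ 2 + x ^+ 2) + e^-1)).
  move=> y; apply: (le_trans (ler_normB _ _)).
  have ex0 : 0 <= e ^+ 2 + x ^+ 2 by rewrite addr_ge0 ?sqr_ge0.
  rewrite (gtr0_norm (x := e^-1)) ?invr_gt0// lerD2r normrM normfV.
  rewrite (ger0_norm ex0) ler_wpM2r ?invr_ge0//.
  apply: (le_trans (ler_normB _ _)); rewrite !normrM (gtr0_norm e0).
  by rewrite lerD// ler_piMr ?(ltW e0)//; [rewrite ler_norml sin_geN1 sin_le1|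
    rewrite ler_norml cos_geN1 cos_le1].
under eq_fun do rewrite mulNr.
have ey : e * y @[y --> +oo] --> +oo by exact: gt0_cvgMry.
exact: (cvg_comp _ (fun y => expR (- y)) ey (@cvgr_expR R)).
Qed.

Let mu := @lebesgue_measure R.

Let laplace0y e x : 0 < e ->
  (\int[mu]_(y in `[0%R, +oo[) (expR (- e * y) * (1 + cos (x * y)))%:E =
   (e^-1 + e / (e ^+ 2 + x ^+ 2))%:E)%E.
Proof.
move=> e0; have dF y := is_derive_primitive x y e0.
have cc : continuous (fun y => expR (- e * y) * (1 + cos (x * y))).
  move=> y; apply: cvgM.
    apply: (@continuous_comp _ _ _ ( *%R (- e)) expR); first exact: mulrl_continuous.
    exact: continuous_expR.
  apply: cvgD; first exact: cvg_cst.
  apply: (@continuous_comp _ _ _ ( *%R x) cos); first exact: mulrl_continuous.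
  exact: continuous_cos.
rewrite (ge0_continuous_FTC2y _ _ (cvg_primitive x e0))/=.
- rewrite /primitive !mulr0 sin0 cos0 expR0 mulr0 sub0r mul1r mulr1 -EFinD.
  by congr EFin; rewrite sub0r opprB mulNr opprK.
- move=> y _; rewrite mulr_ge0 ?expR_ge0// -lerBlDl sub0r cos_geN1//.
- exact: continuous_subspaceT.
- by move=> y _; exact: ex_derive.
- apply: cvg_at_right_filter; apply: differentiable_continuous.
  by apply/derivable1_diffP; exact: ex_derive.
- by move=> y _; rewrite derive1E; exact: derive_val.
Qed.

Let laplaceT e x : 0 < e ->
  (\int[mu]_y (expR (- e * `|y|) * (1 + cos (x * y)))%:E =
   (2 * (e^-1 + e / (e ^+ 2 + x ^+ 2)))%:E)%E.
Proof.
move=> e0; rewrite ge0_symfun_integralT.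
- rewrite -set_itvcy EFinM -laplace0y//; congr (_ * _)%E; apply: eq_integral => y.
  by rewrite inE/= in_itv/= andbT => y0; rewrite ger0_norm.
- by move=> y; rewrite mulr_ge0 ?expR_ge0// -lerBlDl sub0r cos_geN1.
- move=> y; apply: cvgM.
    apply: (@continuous_comp _ _ _ (fun y => - e * `|y|) expR).
      by apply: cvgMl_tmp; exact: norm_continuous.
    exact: continuous_expR.
  apply: cvgD; first exact: cvg_cst.
  apply: (@continuous_comp _ _ _ ( *%R x) cos); first exact: mulrl_continuous.
  exact: continuous_cos.
- by move=> y /=; rewrite normrN mulrN cosN.
Qed.

Lemma measurable_expRNnorm e :
  measurable_fun setT (fun y : measurableTypeR R => expR (- e * `|y|)).
Proof.
apply: continuous_measurable_fun => y.
apply: (@continuous_comp _ _ _ (fun y => - e * `|y|) expR).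
  by apply: cvgMl_tmp; exact: norm_continuous.
exact: continuous_expR.
Qed.

Lemma integrable_expRNnorm e : 0 < e ->
  mu.-integrable setT (fun y => (expR (- e * `|y|))%:E).
Proof.
(* At [x = 0] the factor [1 + cos (x * y)] is 2, so [laplaceT] gives a finite integral for twice the
   exponential. *)
move=> e0; have := laplaceT 0 e0.
under eq_integral do rewrite mul0r cos0.
have m1 := measurable_expRNnorm e.
have m2 : measurable_fun setT (fun y => expR (- e * `|y|) * (1 + 1)).
  exact: measurable_funM.
move=> I2; apply: (@le_integrable _ _ _ mu _ _ _
   (fun y => (expR (- e * `|y|) * (1 + 1))%:E)) => //.
- exact/measurable_EFinP.
- by move=> y _; rewrite lee_fin [leRHS]normrM ler_peMr// ger0_norm// lerDl.
- apply/integrableP; split; first exact/measurable_EFinP.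
  under eq_integral do rewrite gee0_abs ?lee_fin ?mulr_ge0 ?expR_ge0//.
  by rewrite I2 ltry.
Qed.

Lemma integrableM_bounded d (T : measurableType d)
    (m : {measure set T -> \bar R}) (g h : T -> R) M :
  m.-integrable setT (EFin \o g) -> measurable_fun setT h ->
  (forall t, `|h t| <= M) -> m.-integrable setT (fun t => (g t * h t)%:E).
Proof.
move=> ig mh hM; apply: (@le_integrable _ _ _ m _ _ _
  (fun t => M%:E * (g t)%:E)%E) => //.
- apply/measurable_EFinP/measurable_funM => //.
  by apply/measurable_EFinP; exact: measurable_int ig.
- move=> t _; rewrite lee_fin !normrM mulrC ler_wpM2r//.
  by rewrite (le_trans (hM t)) ?ler_norm.
- exact: integrableZl.
Qed.

Lemma norm_cos_le1 (x : R) : `|cos x| <= 1.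
Proof. by rewrite ler_norml cos_geN1 cos_le1. Qed.

Lemma laplace_cos e x : 0 < e ->
  \int[mu]_y (expR (- e * `|y|) * cos (x * y)) = 2 * e / (e ^+ 2 + x ^+ 2).
Proof.
move=> e0.
have i1 := integrable_expRNnorm e0.
have i2 x' : mu.-integrable setT (fun y => (expR (- e * `|y|) * cos (x' * y))%:E).
  apply: (@integrableM_bounded _ _ _ _ _ 1) => //; last first.
    by move=> t; exact: norm_cos_le1.
  apply: continuous_measurable_fun => y.
  apply: (@continuous_comp _ _ _ ( *%R x') cos); first exact: mulrl_continuous.
  exact: continuous_cos.
have key x' : \int[mu]_y expR (- e * `|y|) +
    \int[mu]_y (expR (- e * `|y|) * cos (x' * y)) =
    2 * (e^-1 + e / (e ^+ 2 + x' ^+ 2)).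
  rewrite -RintegralD//; last exact: i2.
  rewrite /Rintegral; under eq_integral do rewrite -[X in X + _]mulr1 -mulrDr.
  by rewrite laplaceT.
(* At frequency 0 the two integrals of [key] coincide, which determines the first one, [A = 2 / e];
   subtracting it from [key x] leaves the cosine integral. *)
have := key 0; under [X in _ + X]eq_Rintegral do rewrite mul0r cos0 mulr1.
have := key x; set A := \int[mu]_y _; set B := \int[mu]_y _.
move=> AB AA.
have {}AA : A = 2 * e^-1.
  suff : e / e ^+ 2 = e^-1 by move: AA; rewrite expr0n/= addr0; lra.
  by field; rewrite gt_eqF.
by rewrite -mulrA; lra.
Qed.

End LaplaceCosine.

(** * Real-valued integrals and integrability on product spaces *)

Lemma EFin_Rintegral d (T : measurableType d) (R : realType)
    (m : {measure set T -> \bar R}) (D : set T) (g : T -> R) :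
  measurable D -> m.-integrable D (EFin \o g) ->
  (\int[m]_(x in D) (g x)%:E)%E = (\int[m]_(x in D) g x)%:E.
Proof. by move=> mD ig; rewrite /Rintegral fineK//; exact: integrable_fin_num. Qed.

(** By Tonelli, the integral of the absolute value factors into two finite integrals. *)
Lemma integrable_prodM d1 d2 (T1 : measurableType d1) (T2 : measurableType d2)
    (R : realType) (m1 : {sigma_finite_measure set T1 -> \bar R})
    (m2 : {sigma_finite_measure set T2 -> \bar R}) (g1 : T1 -> R) (g2 : T2 -> R) :
  m1.-integrable setT (EFin \o g1) -> m2.-integrable setT (EFin \o g2) ->
  (m1 \x m2)%E.-integrable setT (fun p => (g1 p.1 * g2 p.2)%:E).
Proof.
move=> i1 i2.
have mg1 : measurable_fun setT g1 by apply/measurable_EFinP; exact: measurable_int i1.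
have mg2 : measurable_fun setT g2 by apply/measurable_EFinP; exact: measurable_int i2.
apply/integrable12ltyP.
  apply/measurable_EFinP/measurable_funM; apply: measurableT_comp => //.
pose C := (\int[m2]_y `|(g2 y)%:E|)%E.
have Coo : (C < +oo)%E by have /integrableP[] := i2.
have C0 : (0 <= C)%E by exact: integral_ge0.
under eq_integral.
  move=> x _; under eq_integral do rewrite /= normrM EFinM.
  rewrite ge0_integralZl//; last exact/measurable_EFinP/measurableT_comp.
  over.
rewrite ge0_integralZr//; last by apply/measurable_EFinP; exact: measurableT_comp.
rewrite lte_mul_pinfty//; first exact: integral_ge0.
by rewrite ge0_fin_numE ?integral_ge0//; have /integrableP[] := i1.
Qed.

(** * Uniqueness on the line by the Poisson kernel *)

Section UniquenessLine.
Variable R : realType.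
Let mu : {sigma_finite_measure set (measurableTypeR R) -> \bar R} :=
  @lebesgue_measure R.
Implicit Types g h : measurableTypeR R -> R.

Lemma integrableM_cos g a b : mu.-integrable setT (EFin \o g) ->
  mu.-integrable setT (fun x => (g x * cos (a + b * x))%:E).
Proof.
move=> ig; apply: (integrableM_bounded (M := 1)) => //.
  apply: measurableT_comp.
    by apply: continuous_measurable_fun; exact: continuous_cos.
  by apply: measurable_funD => //; exact: measurable_funM.
by move=> x; exact: norm_cos_le1.
Qed.

(** Fubini for [h x * expR (- e * |y|) * cos ((x - z) * y)]: integrating first in [y] produces the
    kernel by [laplace_cos]; integrating first in [x] gives 0, by the hypothesis with phase
    [theta = - (z * y)]. *)
Lemma poisson_pairing h e z : mu.-integrable setT (EFin \o h) -> 0 < e ->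
  (forall y theta, \int[mu]_x (h x * cos (theta + y * x)) = 0) ->
  \int[mu]_x (h x * (2 * e / (e ^+ 2 + (x - z) ^+ 2))) = 0.
Proof.
move=> ih e0 H.
have mh : measurable_fun setT h by apply/measurable_EFinP; exact: measurable_int ih.
pose w (y : measurableTypeR R) := expR (- e * `|y|).
have iw := integrable_expRNnorm e0.
pose f (p : measurableTypeR R * measurableTypeR R) :=
  (h p.1 * w p.2 * cos ((p.1 - z) * p.2))%:E.
have mcos : measurable_fun setT
    (fun p : measurableTypeR R * measurableTypeR R => cos ((p.1 - z) * p.2)).
  apply: measurableT_comp.
    by apply: continuous_measurable_fun; exact: continuous_cos.
  by apply: measurable_funM => //; apply: measurable_funB.
have iF : (mu \x mu)%E.-integrable setT f.
  apply: (integrableM_bounded (g := fun p => h p.1 * w p.2) (M := 1)) => //.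
    exact: (integrable_prodM ih iw).
  by move=> p; exact: norm_cos_le1.
have := Fubini iF; rewrite /f/=.
under eq_integral.
  move=> x _.
  under eq_integral do rewrite -mulrA EFinM -[(x - z) * _]add0r.
  rewrite integralZl//; last exact: integrableM_cos.
  rewrite EFin_Rintegral//; last exact: integrableM_cos.
  under eq_Rintegral do rewrite add0r.
  rewrite laplace_cos// -EFinM.
  over.
under [RHS]eq_integral.
  move=> y _.
  under eq_integral.
    move=> x _; rewrite (mulrC (h x)) -mulrA EFinM.
    rewrite (_ : (x - z) * y = - (z * y) + y * x); last by ring.
    over.
  rewrite integralZl//; last exact: integrableM_cos.
  rewrite EFin_Rintegral// ?H ?mule0; last exact: integrableM_cos.
  over.
by rewrite integral0 /Rintegral => ->.
Qed.

(** If [h z > 0], then for a narrow enough kernel centred at [z] the peak contributes more than the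
    tails can cancel, contradicting [poisson_pairing]. *)
Lemma cos_transform_injective h : continuous (h : R -> R) ->
  mu.-integrable setT (EFin \o h) ->
  (forall y theta, \int[mu]_x (h x * cos (theta + y * x)) = 0) ->
  forall x, h x = 0.
Proof.
(* The hypotheses are stable under [h |-> - h], so a one-sided bound suffices. *)
wlog suff: h / forall z, continuous (h : R -> R) ->
  mu.-integrable setT (EFin \o h) ->
  (forall y theta, \int[mu]_x (h x * cos (theta + y * x)) = 0) -> h z <= 0.
  move=> le0 ch ih H z; apply/eqP; rewrite eq_le le0//= -oppr_le0.
  apply: (le0 (fun x => - h x)).
  - by move=> x; apply: cvgN; exact: ch.
  - by have := integrableN ih.
  - move=> y theta; under eq_Rintegral do rewrite mulNr -mulN1r.
    by rewrite RintegralZl// ?H ?mulr0//; exact: integrableM_cos.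
move=> z ch ih H; rewrite leNgt; apply/negP => hz0.
have [d d0 hd] : exists2 d, 0 < d & forall x, `|x - z| < d -> h z / 2 <= h x.
  have /cvgrPdist_lt/(_ (h z / 2)) := ch z.
  rewrite divr_gt0// => /(_ erefl)/nbhs_ballP[d /= d0 hd]; exists d => // x xd.
  have : `|h z - h x| < h z / 2 by apply: hd; rewrite /ball/= distrC.
  by rewrite ltr_norml => /andP[_]; lra.
pose I := \int[mu]_x `|h x|.
have I0 : 0 <= I by apply: Rintegral_ge0.
have ihn : mu.-integrable setT (fun x => `|h x|%:E) by exact: integrable_norm.
(* The peak will contribute [h z] and the tails at most [2 * e / d ^+ 2 * I]. The second bound on
   [e] makes the tails at most [h z * I / (I + 1)], which is less than [h z]; the [+ 1] also covers
   [I = 0]. *)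
pose e := Num.min d (d ^+ 2 * (h z / 2) / (I + 1)).
have e0 : 0 < e.
  by rewrite lt_min d0 divr_gt0 ?ltr_wpDl ?mulr_gt0 ?exprn_gt0 ?divr_gt0.
have ed : e <= d by rewrite ge_min lexx.
pose K x := 2 * e / (e ^+ 2 + (x - z) ^+ 2).
have K0 x : 0 <= K x by rewrite divr_ge0 ?addr_ge0 ?sqr_ge0 ?mulr_ge0 ?(ltW e0).
pose A := ball z e.
pose lower x := h z / 2 / e * \1_A x - 2 * e / d ^+ 2 * `|h x|.
have e2x x : 0 < e ^+ 2 + (x - z) ^+ 2 by rewrite ltr_wpDr ?sqr_ge0 ?exprn_gt0.
(* On [A] the kernel is at least [1 / e]; off the [d]-ball it is at most
   [2 e / d ^+ 2]; in between [h] and the kernel are nonnegative. *)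
have low x : lower x <= h x * K x.
  have N0 : 0 <= 2 * e / d ^+ 2 * `|h x|.
    by rewrite mulr_ge0// divr_ge0 ?sqr_ge0 ?mulr_ge0 ?(ltW e0).
  rewrite /lower indicE; have [xA|xA] := pselect (A x).
    have xe : `|x - z| < e by rewrite distrC.
    have hx := hd _ (lt_le_trans xe ed).
    rewrite mem_set// mulr1 (@le_trans _ _ (h z / 2 / e))// ?lerBlDr ?lerDl//.
    rewrite ler_pM ?invr_ge0 ?divr_ge0 ?(ltW hz0) ?(ltW e0)// /K ler_pdivlMr//.
    rewrite ler_pdivrMl// -[leRHS]/(e * (2 * e)).
    have : (x - z) ^+ 2 <= e ^+ 2.
      by rewrite -real_normK ?num_real// lerXn2r ?nnegrE ?(ltW e0) ?(ltW xe).
    by rewrite expr2; lra.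
  rewrite memNset// mulr0 sub0r; have [xd|dx] := ltP `|x - z| d.
    rewrite (@le_trans _ _ 0) ?oppr_le0// mulr_ge0//.
    by rewrite (le_trans _ (hd _ xd)) ?divr_ge0 ?(ltW hz0).
  rewrite lerNl (le_trans (ler_norm _))// normrN normrM mulrC (ger0_norm (K0 x)).
  rewrite ler_wpM2r// /K ler_pM ?invr_ge0 ?mulr_ge0 ?(ltW e0) ?(ltW (e2x x))//.
  rewrite lef_pV2 ?posrE ?exprn_gt0//.
  rewrite -[X in X <= _](add0r) lerD ?sqr_ge0//.
  by rewrite -(real_normK (num_real (x - z))) lerXn2r ?nnegrE ?(ltW d0).
have mA : measurable A by exact: measurable_ball.
have AE : mu A = (2 * e)%:E.
  by rewrite /A [LHS]lebesgue_measure_ball ?ltW//= mulr2n mulrDl mul1r.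
have i1 : mu.-integrable setT (EFin \o (\1_A : _ -> R)).
  apply/integrableP; split; first by apply/measurable_EFinP; exact: measurable_indic.
  under eq_integral do rewrite /= ger0_norm//.
  by rewrite integral_indic// setIT [X in (X < _)%E]AE ltry.
have iA : mu.-integrable setT (fun x => (h z / 2 / e * \1_A x)%:E).
  by have := integrableZl measurableT (h z / 2 / e) i1.
have iB : mu.-integrable setT (fun x => (2 * e / d ^+ 2 * `|h x|)%:E).
  by have := integrableZl measurableT (2 * e / d ^+ 2) ihn.
have iL : mu.-integrable setT (EFin \o lower) by have := integrableB measurableT iA iB.
have iK : mu.-integrable setT (fun x => (h x * K x)%:E).
  (* [2 / e] is the maximum of the kernel, attained at [x = z]. *)
  apply: (integrableM_bounded (M := 2 / e)) => //.
    apply: continuous_measurable_fun => x.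
    apply: cvgMl_tmp; apply: cvgV; rewrite ?gt_eqF//.
    apply: cvgD; first exact: cvg_cst.
    by apply: cvgM; apply: cvgB => //; exact: cvg_cst.
  move=> x; rewrite ger0_norm// /K ler_pdivrMr// mulrDr.
  by rewrite expr2 mulrA divfK ?gt_eqF// lerDl mulr_ge0 ?sqr_ge0 ?divr_ge0 ?(ltW e0).
(* Integrating [low] yields [h z - 2 * e / d ^+ 2 * I <= 0], which the choice of [e] excludes. *)
have := le_Rintegral measurableT iL iK (fun x _ => low x).
rewrite poisson_pairing// RintegralB//.
have -> : \int[mu]_x (h z / 2 / e * \1_A x) = h z / 2 / e * (2 * e).
  rewrite RintegralZl//; congr (_ * _).
  by rewrite /Rintegral integral_indic// setIT [X in fine X]AE.
rewrite RintegralZl// -/I.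
have -> : h z / 2 / e * (2 * e) = h z by field; rewrite gt_eqF.
apply/negP; rewrite -ltNge subr_gt0 mulrAC.
rewrite ltr_pdivrMr ?exprn_gt0//.
have : e <= d ^+ 2 * (h z / 2) / (I + 1) by rewrite ge_min lexx orbT.
rewrite ler_pdivlMr ?ltr_wpDl//.
lra.
Qed.

End UniquenessLine.

(** * Dominated functions on tuples and Fubini in the first coordinate *)

Section TupleIntegral.
Variable R : realType.
Local Notation RT := (measurableTypeR R).
Let mu : {sigma_finite_measure set RT -> \bar R} := @lebesgue_measure R.

(** An integrable majorant in product form, so that it factors when the first coordinate is split
    off. *)
Definition weight n (t : n.-tuple RT) : R := \prod_i (oneDsqr (tnth t i : R))^-1.

(** Stands in for the Schwartz condition in the induction on dimension: it involves no derivatives,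
    and survives slicing, reflection, linear combinations and multiplication by waves. *)
Definition dominated n (g : n.-tuple RT -> R) :=
  measurable_fun setT g /\ exists C, forall t, `|g t| <= C * weight t.

Lemma weight_tcons n x (t : n.-tuple RT) :
  weight (tcons (x, t)) = (oneDsqr (x : R))^-1 * weight t.
Proof.
rewrite /weight big_ord_recl; congr (_ * _).
by apply: eq_bigr => i _; rewrite /tcons tnthS.
Qed.

Lemma weight_ge0 n (t : n.-tuple RT) : 0 <= weight t.
Proof. by apply: prodr_ge0 => i _; rewrite invr_ge0. Qed.

Lemma measurable_oneDsqrV : measurable_fun setT (fun x : RT => (oneDsqr (x : R))^-1).
Proof. by apply: continuous_measurable_fun; exact: continuous_oneDsqrV. Qed.

Lemma measurable_weight n : measurable_fun setT (@weight n).
Proof.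
apply: measurable_prod => i _.
apply: (measurableT_comp measurable_oneDsqrV); exact: measurable_tnth.
Qed.

Lemma integrable_oneDsqrV : mu.-integrable setT (fun x => ((oneDsqr (x : R))^-1)%:E).
Proof.
apply/integrableP; split.
  by apply/measurable_EFinP; exact: measurable_oneDsqrV.
under eq_integral do rewrite /= ger0_norm ?invr_ge0//.
rewrite ge0_symfun_integralT.
- by rewrite -set_itvcy integral0y_oneDsqr -EFinM ltry.
- by move=> x; rewrite invr_ge0.
- exact: continuous_oneDsqrV.
- by move=> x; rewrite /= /oneDsqr sqrrN.
Qed.

Lemma integrable_tcons n (g : n.+1.-tuple RT -> R) : measurable_fun setT g ->
  (mu \x lebesgue_tuple R n)%E.-integrable setT (EFin \o (g \o @tcons R n)) ->
  (lebesgue_tuple R n.+1).-integrable setT (EFin \o g).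
Proof.
move=> /measurable_EFinP mg ig.
exact: (@integrable_pushforward _ _ _ _ _ _ (@measurable_tcons R n)
  (lebesgue_measure \x lebesgue_tuple R n)%E _ _ mg ig measurableT).
Qed.

Lemma integrable_weight n : (lebesgue_tuple R n).-integrable setT (EFin \o @weight n).
Proof.
elim: n => [|n IHn].
  apply/integrableP; split; first by apply/measurable_EFinP; exact: measurable_weight.
  rewrite integral_dirac//; last first.
    by apply: measurableT_comp => //; apply/measurable_EFinP; exact: measurable_weight.
  by rewrite diracT mul1e /= ltry.
apply: integrable_tcons; first exact: measurable_weight.
rewrite (_ : _ \o _ = fun p => ((oneDsqr (p.1 : R))^-1 * weight p.2)%:E); last first.
  by apply/funext => -[x t]; rewrite /= weight_tcons.
exact: (integrable_prodM integrable_oneDsqrV).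
Qed.

Lemma dominated_integrable n (g : n.-tuple RT -> R) : dominated g ->
  (lebesgue_tuple R n).-integrable setT (EFin \o g).
Proof.
move=> [mg [C gC]].
apply: (@le_integrable _ _ _ _ _ _ _ (fun t => C%:E * (weight t)%:E)%E) => //.
- exact/measurable_EFinP.
- by move=> t _; rewrite lee_fin (le_trans (gC t)) ?ler_norm.
- exact/integrableZl/integrable_weight.
Qed.

Lemma dominated_bounded n (g h : n.-tuple RT -> R) : dominated g ->
  measurable_fun setT h -> (forall t, `|h t| <= 1) ->
  dominated (fun t => g t * h t).
Proof.
move=> [mg [C gC]] mh h1; split; first exact: measurable_funM.
by exists C => t; rewrite normrM (le_trans _ (gC t))// ler_piMr.
Qed.

Lemma dominatedD n (g h : n.-tuple RT -> R) : dominated g -> dominated h ->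
  dominated (fun t => g t + h t).
Proof.
move=> [mg [C gC]] [mh [D hD]]; split; first exact: measurable_funD.
by exists (C + D) => t; rewrite mulrDl (le_trans (ler_normD _ _))// lerD.
Qed.

Lemma dominatedZ n (g : n.-tuple RT -> R) c : dominated g ->
  dominated (fun t => c * g t).
Proof.
move=> [mg [C gC]]; split; first exact: measurable_funM.
by exists (`|c| * C) => t; rewrite normrM -mulrA ler_wpM2l.
Qed.

Lemma dominated_slice n (g : n.+1.-tuple RT -> R) x : dominated g ->
  dominated (fun t => g (tcons (x, t))).
Proof.
move=> [mg [C gC]]; split.
  apply: (measurableT_comp mg); apply: (measurableT_comp (@measurable_tcons R n)).
  exact: pair1_measurable.
exists (C * (oneDsqr (x : R))^-1) => t.
by rewrite (le_trans (gC _))// weight_tcons mulrA.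
Qed.

(** The measure is the image of a product under [tcons], so this is Fubini. Domination makes every
    slice integrable, not just almost every one, so the inner real integral is nowhere a default
    value. *)
Lemma Rintegral_tcons n (g : n.+1.-tuple RT -> R) : dominated g ->
  \int[lebesgue_tuple R n.+1]_t g t =
  \int[mu]_x \int[lebesgue_tuple R n]_t g (tcons (x, t)).
Proof.
move=> dg; have [mg [C gC]] := dg.
have ig : (mu \x lebesgue_tuple R n)%E.-integrable setT (EFin \o (g \o @tcons R n)).
  apply: (@le_integrable _ _ _ (mu \x lebesgue_tuple R n)%E _ _ _
    (fun p : RT * n.-tuple RT => C%:E * ((oneDsqr (p.1 : R))^-1 * weight p.2)%:E)%E) => //.
  - apply/measurable_EFinP; apply: (measurableT_comp mg); exact: measurable_tcons.
  - by move=> [x t] _; rewrite lee_fin (le_trans (gC _))// weight_tcons ler_norm.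
  - apply: integrableZl => //.
    exact: (integrable_prodM integrable_oneDsqrV (integrable_weight n)).
rewrite /Rintegral; congr fine.
rewrite [LHS](integral_pushforward (@measurable_tcons R n)
  (mu := (lebesgue_measure \x lebesgue_tuple R n)%E))//; last exact/measurable_EFinP.
rewrite -[LHS]integral12_prod_meas1//; apply: eq_integral => x _.
rewrite -[RHS]EFin_Rintegral//.
exact/dominated_integrable/dominated_slice.
Qed.

End TupleIntegral.

(** * Uniqueness in several variables, by induction on the dimension *)

Section UniquenessTuple.
Variable R : realType.
Local Notation RT := (measurableTypeR R).
Let mu : {sigma_finite_measure set RT -> \bar R} := @lebesgue_measure R.

(* Weaker than continuity, and inherited by the slices [t |-> g (tcons (x, t))]
   without a topology on tuples. *)
Definition curve_continuous n (g : n.-tuple RT -> R) := forall u : R -> n.-tuple RT,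
  (forall i, continuous (fun x => tnth (u x) i : R)) ->
  continuous (fun x => g (u x)).

(** Frequencies are functions of the index, so that dropping the first one is composition with
    [lift ord0]. *)
Definition phase n (s : 'I_n -> R) (t : n.-tuple RT) : R := \sum_i s i * tnth t i.

Lemma phase_tcons n (s : 'I_n.+1 -> R) x (t : n.-tuple RT) :
  phase s (tcons (x, t)) = s ord0 * x + phase (s \o lift ord0) t.
Proof.
rewrite /phase big_ord_recl; congr (_ + _).
by apply: eq_bigr => i _; rewrite /tcons tnthS.
Qed.

Lemma measurable_cos_phase n theta (s : 'I_n -> R) :
  measurable_fun setT (fun t => cos (theta + phase s t)).
Proof.
apply: measurableT_comp.
  by apply: continuous_measurable_fun; exact: continuous_cos.
apply: measurable_funD => //; apply: measurable_sum => i.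
by apply: measurable_funM => //; exact: measurable_tnth.
Qed.

Lemma dominated_cos_phase n (g : n.-tuple RT -> R) theta s : dominated g ->
  dominated (fun t => g t * cos (theta + phase s t)).
Proof.
move=> dg; apply: dominated_bounded => //; first exact: measurable_cos_phase.
by move=> t; exact: norm_cos_le1.
Qed.

Lemma curve_continuous_slice n (g : n.+1.-tuple RT -> R) x : curve_continuous g ->
  curve_continuous (fun t => g (tcons (x, t))).
Proof.
move=> cg u cu; apply: (cg (fun z => tcons (x, u z))) => i.
case: (unliftP ord0 i) => [j ->|->].
  rewrite (_ : (fun _ => _) = fun z => tnth (u z) j)//.
  by apply/funext => z; rewrite /tcons tnthS.
rewrite (_ : (fun _ => _) = fun z => x)//; move=> ?; exact: cvg_cst.
Qed.

(** * The transform in all variables but the first *)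

Section PartialTransform.
Variables (n : nat) (g : n.+1.-tuple RT -> R) (theta : R) (s : 'I_n -> R).
Hypotheses (dg : dominated g) (cg : curve_continuous g).

Let h (x : RT) :=
  \int[lebesgue_tuple R n]_t (g (tcons (x, t)) * cos (theta + phase s t)).

Let dominated_h x : dominated (fun t => g (tcons (x, t)) * cos (theta + phase s t)).
Proof. exact/dominated_cos_phase/dominated_slice. Qed.

(** Dominated convergence: since [1 / (1 + x ^+ 2) <= 1], the majorant [C * weight t] serves for all
    [x] at once. *)
Lemma continuous_partial_transform : continuous (h : R -> R).
Proof.
move=> x; have [mg [C gC]] := dg.
apply: (@continuity_under_integral R _ _ (lebesgue_tuple R n)
  (fun x t => g (tcons (x, t)) * cos (theta + phase s t)) setT _ (x - 1) (x + 1)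
  _ _ (fun t => C * weight t)) => //.
- by move=> z _; exact: dominated_integrable.
- apply: aeW => t _ z _.
  apply: cvgMr_tmp; apply: (cg (u := fun z => tcons (z, t))) => i.
  case: (unliftP ord0 i) => [j ->|->]; last by move=> ?; exact: cvg_id.
  rewrite (_ : (fun _ => _) = fun z => tnth t j); first by move=> ?; exact: cvg_cst.
  by apply/funext => z'; rewrite /tcons tnthS.
- by have := integrableZl measurableT C (@integrable_weight R n).
- move=> z _; apply: aeW => t _.
  have o1 : 0 < oneDsqr (z : R) by rewrite (lt_le_trans _ (oneDsqr_ge1 _)).
  have := gC (tcons (z, t)); rewrite weight_tcons mulrCA => gCt.
  (* The sign of [C] is not given; it is read off from the bound, whose left side is an absolute
     value. *)
  have C0 : 0 <= C * weight t.
    by rewrite -(pmulr_rge0 (x := (oneDsqr (z : R))^-1)) ?invr_gt0// (le_trans _ gCt).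
  rewrite normrM (le_trans (ler_pM _ _ gCt (norm_cos_le1 _)))// mulr1.
  by rewrite ler_piMl// oneDsqrV_le1.
- by rewrite inE/= in_itv/=; apply/andP; split; lra.
Qed.

(** The weight factors, so the transform is at most [C * W / (1 + x ^+ 2)] in absolute value, with
    [W] the total weight in the remaining variables. *)
Lemma integrable_partial_transform : mu.-integrable setT (EFin \o h).
Proof.
have [mg [C gC]] := dg.
pose W := \int[lebesgue_tuple R n]_t weight t.
apply: (@le_integrable _ _ _ mu _ _ _
  (fun x => (C * W)%:E * ((oneDsqr (x : R))^-1)%:E)%E) => //.
- apply/measurable_EFinP; apply: continuous_measurable_fun.
  exact: continuous_partial_transform.
- move=> x _; rewrite lee_fin (le_trans (le_normr_Rintegral _ _))//.
    exact: dominated_integrable.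
  rewrite (@le_trans _ _ (\int[lebesgue_tuple R n]_t
    (C * (oneDsqr (x : R))^-1 * weight t)))//.
    apply: le_Rintegral => //.
    + by apply: integrable_norm => //; exact: dominated_integrable.
    + by have := integrableZl measurableT (C * (oneDsqr (x : R))^-1)
        (@integrable_weight R n).
    + move=> t _; rewrite normrM -mulrA -weight_tcons.
      by rewrite (le_trans _ (gC _))// ler_piMr// norm_cos_le1.
  rewrite RintegralZl//; last exact: integrable_weight.
  by rewrite mulrAC ler_norm.
- by apply: integrableZl => //; exact: integrable_oneDsqrV.
Qed.

(** The product formula [cos A * cos B = (cos (A + B) + cos (A - B)) / 2], with [A = eta + y * x]
    and [B = theta + phase s t], turns the iterated integral into two integrals against waves in all
    variables. *)
Lemma partial_transform_cos y eta :
  (forall r sigma,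
    \int[lebesgue_tuple R n.+1]_t (g t * cos (sigma + phase r t)) = 0) ->
  \int[mu]_x (h x * cos (eta + y * x)) = 0.
Proof.
move=> H.
(* The frequency is [y] in the first variable and [s] or [- s] in the others, the sign being that of
   [B] in [A + B] or [A - B]. *)
pose r (b : bool) (i : 'I_n.+1) :=
  if unlift ord0 i is Some j then (-1) ^+ b * s j else y.
pose G (b : bool) t := g t * cos (eta + (-1) ^+ b * theta + phase (r b) t).
have dG b : dominated (G b) by exact: dominated_cos_phase.
have GE b x t : G b (tcons (x, t)) =
    g (tcons (x, t)) * cos (eta + y * x + (-1) ^+ b * (theta + phase s t)).
  congr (_ * cos _); rewrite phase_tcons /r unlift_none.
  have -> : phase (r b \o lift ord0) t = (-1) ^+ b * phase s t.
    by rewrite /phase mulr_sumr; apply: eq_bigr => i _; rewrite /= /r liftK mulrA.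
  ring.
have : \int[lebesgue_tuple R n.+1]_t (2^-1 * (G false t + G true t)) = 0.
  have i2 : (lebesgue_tuple R n.+1).-integrable setT
      (EFin \o (fun t => G false t + G true t)).
    by apply: dominated_integrable; exact: dominatedD.
  rewrite RintegralZl// RintegralD//; try exact: dominated_integrable.
  by rewrite !H addr0 mulr0.
rewrite Rintegral_tcons; last by apply/dominatedZ/dominatedD.
move=> <-; apply: eq_Rintegral => x _.
rewrite -RintegralZr//; last exact: dominated_integrable.
apply: eq_Rintegral => t _; rewrite !GE -mulrDr mulrCA -mulrA; congr (_ * _).
rewrite !(expr0, expr1, mul1r, mulN1r).
rewrite [cos (eta + _ + _)]cosD [cos (eta + _ - _)]cosB.
by field.
Qed.

End PartialTransform.

(** For fixed [s] and [theta] the partial transform vanishes at every [x] by the one-variable case.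
    Hence each slice of [g] has vanishing integrals against all waves, and the induction hypothesis
    applies to it. *)
Theorem cos_transform_tuple_injective n (g : n.-tuple RT -> R) :
  dominated g -> curve_continuous g ->
  (forall s theta, \int[lebesgue_tuple R n]_t (g t * cos (theta + phase s t)) = 0) ->
  forall t, g t = 0.
Proof.
elim: n g => [|n IHn] g dg cg H t.
  (* In dimension 0 the measure is a unit mass and this wave is 1, so the integral is the only value
     of [g]. *)
  have := H (fun=> 0) 0.
  rewrite /Rintegral integral_dirac//; last first.
    apply/measurable_EFinP; apply: measurable_funM; first by case: dg.
    exact: measurable_cos_phase.
  by rewrite diracT mul1e /= /phase big_ord0 addr0 cos0 mulr1 [t]tuple0.
suff g0 x t' : g (tcons (x, t')) = 0.
  by rewrite [t]tuple_eta; exact: g0 (thead t) [tuple of behead t].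
apply: (IHn (fun t => g (tcons (x, t)))).
- exact: dominated_slice.
- exact: curve_continuous_slice.
- move=> s theta.
  apply: (@cos_transform_injective R (fun x => \int[lebesgue_tuple R n]_t
    (g (tcons (x, t)) * cos (theta + phase s t)))).
  + exact: continuous_partial_transform.
  + exact: integrable_partial_transform.
  + by move=> y eta; exact: partial_transform_cos.
Qed.

End UniquenessTuple.

(** * Invariance of Lebesgue measure under reflection *)

Section Negation.
Variable R : realType.
Local Notation RT := (measurableTypeR R).

Definition tneg n (t : n.-tuple RT) : n.-tuple RT := [tuple - (tnth t i : R) | i < n].

Lemma tnth_tneg n (t : n.-tuple RT) i : tnth (tneg t) i = - (tnth t i : R).
Proof. by rewrite tnth_mktuple. Qed.

Lemma tneg_tcons n (p : RT * n.-tuple RT) :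
  tneg (tcons p) = tcons ((- (p.1 : R) : RT), tneg p.2).
Proof.
apply: eq_from_tnth => i; rewrite tnth_tneg.
by case: (unliftP ord0 i) => [j ->|->//]; rewrite /tcons !tnthS tnth_tneg.
Qed.

Lemma measurable_opp : measurable_fun setT (-%R : RT -> RT).
Proof. exact: oppr_measurable. Qed.

Lemma measurable_tneg n : measurable_fun setT (@tneg n).
Proof.
apply/measurable_fun_tnthP => i.
rewrite (_ : _ \o _ = (-%R : RT -> RT) \o (fun t => tnth t i)); last first.
  by apply/funext => t /=; rewrite tnth_tneg.
by apply: (measurableT_comp measurable_opp); exact: measurable_tnth.
Qed.

(** Through [tcons] the reflection acts on each factor separately; on rectangles the claim is the
    one-dimensional invariance times the induction hypothesis, and a product measure is determined
    by its rectangles. *)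
Lemma pushforward_tneg n A : measurable A ->
  pushforward (lebesgue_tuple R n) (@tneg n) A = lebesgue_tuple R n A.
Proof.
elim: n A => [|n IHn] A mA.
  by rewrite /pushforward; congr (_ _); apply/seteqP; split => t /=;
    rewrite [t]tuple0 [tneg _]tuple0.
pose phi (p : RT * n.-tuple RT) := ((- (p.1 : R) : RT), tneg p.2).
have mphi : measurable_fun setT phi.
  apply: measurable_fun_pair.
    exact: (measurableT_comp measurable_opp).
  by apply: (measurableT_comp (@measurable_tneg n)).
pose m := pushforward (lebesgue_measure \x lebesgue_tuple R n)%E phi.
have mcons : measurable (@tcons R n @^-1` A).
  by rewrite -[X in measurable X]setTI; exact: measurable_tcons.
transitivity (m (@tcons R n @^-1` A)).
  rewrite /m /pushforward; congr (product_measure1 _ _ _).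
  apply/seteqP; split => p /=.
    by rewrite -tneg_tcons.
  by rewrite -tneg_tcons.
apply/esym/product_measure_unique => // B C mB mC.
have mB' : measurable ((-%R : RT -> RT) @^-1` B).
  by rewrite -[X in measurable X]setTI; exact: measurable_opp.
have mC' : measurable (@tneg n @^-1` C).
  by rewrite -[X in measurable X]setTI; exact: measurable_tneg.
rewrite [LHS](product_measure1E lebesgue_measure (lebesgue_tuple R n) mB' mC').
by congr (_ * _)%E; [exact: lebesgue_measureN|exact: IHn].
Qed.

End Negation.

(** * Continuity on rows implies measurability on tuples *)

Section ContinuousMeasurable.
Variable R : realType.
Local Notation RT := (measurableTypeR R).

(** The topology lives on rows and the product sigma-algebra on tuples. They are linked by writing
    an open set as a countable union of balls with rational centres, since balls of the sup norm are
    boxes. *)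
Lemma continuous_measurable_vec n (f : 'rV[R]_n -> R) : continuous f ->
  measurable_fun setT (fun t : n.-tuple RT => f (vec t)).
Proof.
move=> cf.
have open_vec O : open O -> measurable [set t : n.-tuple RT | O (vec t)].
  move=> oO.
  pose I := (nat * {ffun 'I_n -> rat})%type.
  pose q (i : I) : 'rV[R]_n := \row_j ratr (i.2 j).
  pose B (i : I) := [set t : n.-tuple RT | ball (q i) i.1.+1%:R^-1 (vec t)
    /\ ball (q i) i.1.+1%:R^-1 `<=` O].
  rewrite (_ : mkset _ = \bigcup_i B i); last first.
    apply/seteqP; split => [t Ot|t [i _ [ti]]]; last exact.
    have /nbhs_ballP[e /= e0 eO] : nbhs (vec t) O by exact: open_nbhs_nbhs.
    (* If the rational centre is within [d < e / 2] of [vec t], its [d]-ball stays in the [e]-ball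
       around [vec t], hence in [O]. *)
    have [k] : exists k, (k.+1%:R^-1 : R) < e / 2.
      exists (Num.trunc (e / 2)^-1); rewrite invf_plt ?posrE ?divr_gt0//.
      by apply: truncnS_gt.
    have : 0 < (k.+1%:R^-1 : R) by rewrite invr_gt0.
    set d : R := k.+1%:R^-1 => d0 de.
    have /fin_all_exists[r hr] : forall i : 'I_n, exists r : rat,
        `|(tnth t i : R) - ratr r| < d.
      move=> i; set x : R := tnth t i.
      have [|r] := @rat_in_itvoo R (x - d) (x + d).
        by lra.
      rewrite in_itv/= => /andP[r1 r2]; exists r.
      by rewrite ltr_norml; apply/andP; split; lra.
    exists (k, [ffun i => r i]) => //; split => [|x qx].
      split => // i j; rewrite !mxE ffunE /ball/= distrC; exact: hr.
    apply: eO; split => // i j; move: (qx.2 i j); rewrite /ball/= !mxE ffunE -/d.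
    have := hr j; rewrite !ltr_norml => /andP[? ?] /andP[? ?].
    by apply/andP; split; lra.
  apply: countable_bigcupT_measurable; first exact: countableP.
  move=> i; have [BO|nBO] := pselect (ball (q i) i.1.+1%:R^-1 `<=` O); last first.
    by rewrite (_ : B i = set0)//; apply/seteqP; split => // t [].
  rewrite (_ : B i = \bigcap_(j in [set: 'I_n])
      ((fun t => tnth t j) @^-1` ball (ratr (i.2 j) : R) i.1.+1%:R^-1)); last first.
    apply/seteqP; split => t.
      by move=> [[_ h] _] j _; have := h ord0 j; rewrite !mxE.
    move=> h; split => //; split => [|k j]; first by rewrite invr_gt0.
    by rewrite !mxE; exact: h.
  apply: fin_bigcap_measurable => // j _; rewrite -[X in measurable X]setTI.
  apply: measurable_tnth => //; exact: measurable_ball.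
apply: (measurability _ (RGenOpens.measurableE R)).
move=> _ [_ [a [b ->] <-]]; rewrite setTI; apply: (open_vec (f @^-1` `]a, b[)).
by move/continuousP : cf; apply; exact: interval_open.
Qed.

End ContinuousMeasurable.

(** * Schwartz functions are dominated and continuous along curves *)

Section SchwartzDecay.
Variable R : realType.
Local Notation RT := (measurableTypeR R).

Lemma continuous_row n (u : R -> n.-tuple RT) :
  (forall i, continuous (fun x => tnth (u x) i : R)) ->
  continuous (fun x => vec (u x)).
Proof.
move=> cu x; apply/cvg_ballP => e e0.
have ux i : nbhs x (fun z => ball (tnth (u x) i : R) e (tnth (u z) i)).
  by have /cvg_ballP := cu i x; exact.
have FF : Filter (nbhs (x : R)) by exact: nbhs_filter.
have := @filter_forall _ _ _ _ FF ux.
apply: (@filterS _ _ FF) => z uz; split => // i j; rewrite /= !mxE; exact: uz.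
Qed.

Lemma schwartz_curve_continuous n (f : 'rV[R]_n -> R) : schwartz f ->
  curve_continuous (fun t => f (vec t)).
Proof.
move=> [/(_ [::])[/= cf _] _] u cu x.
apply: (@continuous_comp _ _ _ (fun x => vec (u x)) f); last exact: cf.
exact: continuous_row.
Qed.

(** The inverse weight, the product of the [1 + t_i ^+ 2], expands into monomials with exponents 0
    or 2, one for each subset of the coordinates; each of them times [f] is bounded. *)
Lemma schwartz_bound n (f : 'rV[R]_n -> R) : schwartz f ->
  exists C, forall t : n.-tuple RT, `|f (vec t)| <= C * weight t.
Proof.
move=> [_ df].
have /choice[C hC] a : exists C, forall x, `|monomial a x * f x| <= C.
  (* The zero multi-index takes no derivative. *)
  have [C hC] := df a [ffun=> 0%N]; exists C => x; move: (hC x).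
  rewrite (_ : multi_partial _ f = f)// /multi_partial.
  by elim: (enum _) => //= i s ->; rewrite ffunE.
pose a (c : {ffun 'I_n -> bool}) : {ffun 'I_n -> nat} := [ffun i => (c i).*2].
exists (\sum_c C (a c)) => t.
rewrite /weight prodfV ler_pdivlMr; last first.
  by apply: prodr_gt0 => i _; rewrite (lt_le_trans _ (oneDsqr_ge1 _)).
have -> : \prod_i oneDsqr (tnth t i : R) = \sum_c monomial (a c) (vec t).
  rewrite (eq_bigr (fun i => \sum_b (tnth t i : R) ^+ (b : bool).*2)); last first.
    by move=> i _; rewrite big_bool/= expr0 addrC.
  rewrite bigA_distr_bigA; apply: eq_bigr => c _; apply: eq_bigr => i _.
  by rewrite ffunE mxE.
rewrite mulrC -[X in X * _]ger0_norm ?sumr_ge0//; last first.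
  move=> c _; apply: prodr_ge0 => i _; rewrite ffunE; case: (c i) => //=.
  by rewrite sqr_ge0.
by rewrite -normrM mulr_suml (le_trans (ler_norm_sum _ _ _))// ler_sum.
Qed.

Lemma schwartz_dominated n (f : 'rV[R]_n -> R) : schwartz f ->
  dominated (fun t => f (vec t)).
Proof.
move=> sf; split; last exact: schwartz_bound.
by apply: continuous_measurable_vec; have [/(_ [::])[]] := sf.
Qed.

End SchwartzDecay.

(** * Injectivity and reflection for the cosine-minus-sine transform *)

Section HartleyTransform.
Variable R : realType.
Local Notation RT := (measurableTypeR R).

(** The Hartley transform up to normalisation and the sign of the frequency. *)
Definition hartley n (g : n.-tuple RT -> R) (s : 'I_n -> R) : R :=
  \int[lebesgue_tuple R n]_t (g t * (cos (phase s t) - sin (phase s t))).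

Lemma phaseN n (s : 'I_n -> R) t : phase (fun i => - s i) t = - phase s t.
Proof. by rewrite /phase -sumrN; apply: eq_bigr => i _; rewrite mulNr. Qed.

Lemma phase_tneg n (s : 'I_n -> R) t : phase s (tneg t) = - phase s t.
Proof. by rewrite /phase -sumrN; apply: eq_bigr => i _; rewrite tnth_tneg mulrN. Qed.

(** Presents the kernel as a sum of two waves, to which [dominated_cos_phase] applies. *)
Lemma cos_sub_sin (x : R) : cos x - sin x = cos (0 + x) + cos (pi / 2 + x).
Proof. by rewrite add0r addrC [pi / 2 + x]addrC cosDpihalf addrC. Qed.

Lemma dominated_cos_sub_sin n (g : n.-tuple RT -> R) s : dominated g ->
  dominated (fun t => g t * (cos (phase s t) - sin (phase s t))).
Proof.
move=> dg.
under eq_fun do rewrite cos_sub_sin mulrDr.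
by apply: dominatedD; exact: dominated_cos_phase.
Qed.

Lemma hartley_lin n (g h : n.-tuple RT -> R) a s : dominated g -> dominated h ->
  hartley (fun t => g t - a * h t) s = hartley g s - a * hartley h s.
Proof.
move=> dg dh; have ig := dominated_integrable (dominated_cos_sub_sin s dg).
have ih := dominated_integrable (dominated_cos_sub_sin s dh).
have iah := dominated_integrable (dominatedZ a (dominated_cos_sub_sin s dh)).
rewrite /hartley -RintegralZl// -RintegralB//; apply: eq_Rintegral => t _.
by rewrite mulrBl mulrA.
Qed.

Lemma hartley_injective n (g : n.-tuple RT -> R) : dominated g -> curve_continuous g ->
  (forall s, hartley g s = 0) -> forall t, g t = 0.
Proof.
move=> dg cg H; apply: cos_transform_tuple_injective => // s theta.
(* Solves [a + b = cos theta] and [a - b = sin theta], the coefficients needed to write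
   [cos (theta + p)] by the kernels at [p] and [- p]. *)
pose a := (cos theta + sin theta) / 2; pose b := (cos theta - sin theta) / 2.
pose G s t := g t * (cos (phase s t) - sin (phase s t)).
have dG s' : dominated (G s') by exact: dominated_cos_sub_sin.
transitivity (\int[lebesgue_tuple R n]_t (a * G s t + b * G (fun i => - s i) t)).
  by apply: eq_Rintegral => t _; rewrite /G phaseN cosN sinN cosD /a /b; field.
rewrite RintegralD//; [|exact/dominated_integrable/dominatedZ..].
rewrite !RintegralZl//; [|exact: dominated_integrable..].
by rewrite -!/(hartley _ _) !H !mulr0 addr0.
Qed.

Lemma weight_tneg n (t : n.-tuple RT) : weight (tneg t) = weight t.
Proof. by apply: eq_bigr => i _; rewrite tnth_tneg /oneDsqr sqrrN. Qed.

Lemma dominated_tneg n (g : n.-tuple RT -> R) : dominated g ->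
  dominated (fun t => g (tneg t)).
Proof.
move=> [mg [C gC]]; split; first by apply: (measurableT_comp mg); exact: measurable_tneg.
by exists C => t; rewrite -weight_tneg.
Qed.

Lemma curve_continuous_tneg n (g : n.-tuple RT -> R) : curve_continuous g ->
  curve_continuous (fun t => g (tneg t)).
Proof.
move=> cg u cu; apply: (cg (fun x => tneg (u x))) => i x.
by under eq_fun do rewrite tnth_tneg; apply: cvgN; exact: cu.
Qed.

(** Change of variables by [tneg], which preserves the measure and negates the phase. *)
Lemma hartleyN n (g : n.-tuple RT -> R) s : dominated g ->
  hartley g (fun i => - s i) = hartley (fun t => g (tneg t)) s.
Proof.
move=> dg; have dG := dominated_cos_sub_sin (fun i => - s i) dg.
have mG := (measurable_EFinP _ _).2 dG.1.
have ig := dominated_integrable (dominated_tneg dG).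
rewrite /hartley /Rintegral; congr fine.
transitivity (\int[pushforward (lebesgue_tuple R n) (@tneg R n)]_t
    (g t * (cos (phase (fun i => - s i) t) - sin (phase (fun i => - s i) t)))%:E)%E.
  apply: eq_measure_integral; first exact: measurable_tneg.
  by move=> mt A mA _; apply/esym; exact: pushforward_tneg.
rewrite integral_pushforward//; last exact: measurable_tneg.
by apply: eq_integral => t _; rewrite /= phaseN phase_tneg opprK.
Qed.

Lemma vec_tneg n (t : n.-tuple RT) : vec (tneg t) = - vec t.
Proof. by apply/rowP => i; rewrite !mxE tnth_tneg. Qed.

Lemma real_fourierE n (f : 'rV[R]_n -> R) y : real_fourier f y =
  (Num.sqrt ((2 * pi) ^+ n))^-1 * hartley (fun t => f (vec t)) (fun i => y 0 i).
Proof.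
congr (_ * _); apply: eq_Rintegral => t _.
suff -> : dot y (vec t) = phase (fun i => y 0 i) t by [].
by apply: eq_bigr => i _; rewrite mxE.
Qed.

(** Treats both parities at once, with [a = 1] and [a = - 1]. By [FN] the defect [f (- x) - a * f x]
    is transformed into the corresponding defect of [real_fourier f]; injectivity gives the converse
    direction. *)
Lemma schwartz_reflection_iff n (f : 'rV[R]_n -> R) a : schwartz f ->
  (forall x, f (- x) = a * f x) <->
  (forall y, real_fourier f (- y) = a * real_fourier f y).
Proof.
move=> sf; pose g t := f (vec t); pose c : R := (Num.sqrt ((2 * pi) ^+ n))^-1.
have c0 : c != 0 by rewrite invr_eq0 gt_eqF// sqrtr_gt0 exprn_gt0// mulr_gt0// pi_gt0.
have dg : dominated g := schwartz_dominated sf.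
have dgN := dominated_tneg dg.
have FN y : real_fourier f (- y) - a * real_fourier f y =
    c * hartley (fun t => g (tneg t) - a * g t) (fun i => y 0 i).
  rewrite hartley_lin// -hartleyN// !real_fourierE -/c.
  have -> : (fun i => (- y) 0 i) = (fun i => - y 0 i) by apply/funext => i; rewrite mxE.
  by rewrite /g; ring.
split=> [fa y|Fa x].
  have g0 : (fun t => g (tneg t) - a * g t) = fun=> 0.
    by apply/funext => t; rewrite /g vec_tneg fa subrr.
  apply/eqP; rewrite -subr_eq0 FN g0 /hartley /Rintegral.
  under eq_integral do rewrite /= mul0r.
  by rewrite integral0 mulr0.
pose t : n.-tuple RT := [tuple x 0 i | i < n].
have -> : x = vec t by apply/rowP => i; rewrite mxE tnth_mktuple.
apply/eqP; rewrite -subr_eq0 -vec_tneg; apply/eqP.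
apply: (hartley_injective (g := fun t => g (tneg t) - a * g t)).
- have := dominatedD dgN (dominatedZ (- a) dg).
  by under eq_fun do rewrite mulNr.
- move=> u cu z; apply: cvgB; last apply: cvgMl_tmp.
    exact: (curve_continuous_tneg (schwartz_curve_continuous sf) cu).
  exact: (schwartz_curve_continuous sf cu).
(* Every frequency function [s] comes from a row, and [c] is nonzero, so the transform of the defect
   vanishes everywhere. *)
- move=> s; have := FN (\row_i s i).
  rewrite Fa subrr => /esym/eqP; rewrite mulf_eq0 (negbTE c0)/= => /eqP.
  by congr (hartley _ _ = 0); apply/funext => i; rewrite mxE.
Qed.

End HartleyTransform.

Theorem proposition2 (R : realType) (n : nat) (hn : (1 <= n)%N)
    (f : 'rV[R]_n -> R) (hf : schwartz f) :
  (parity_even f <-> parity_even (real_fourier f)) /\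
  (parity_odd f <-> parity_odd (real_fourier f)).
Proof.
have evenE (g : 'rV[R]_n -> R) : parity_even g <-> forall x, g (- x) = 1 * g x.
  by split=> h x; rewrite h mul1r.
have oddE (g : 'rV[R]_n -> R) : parity_odd g <-> forall x, g (- x) = (- 1) * g x.
  by split=> h x; rewrite h mulN1r.
have F a := schwartz_reflection_iff a hf; split.
- exact: iff_trans (iff_trans (evenE _) (F _)) (iff_sym (evenE _)).
- exact: iff_trans (iff_trans (oddE _) (F _)) (iff_sym (oddE _)).
Qed.
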